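(* The classes $\mathcal A^\infty_{K_1,\infty,\infty,\infty}$ for $1\le K_1\le\infty$, and the class $\mathcal A^\infty_{\infty,0,\infty,\infty}$, have coherent EPPA.
   Context: For $1\le K_1\le\infty$, $\mathcal A^\infty_{K_1,\infty,\infty,\infty}$ is the class of all finite metric spaces with positive integer distances containing no triangle of odd perimeter $p$ with $p<2K_1+1$ (for $K_1=\infty$: no triangle of odd perimeter at all). $\mathcal A^\infty_{\infty,0,\infty,\infty}$ is the class of all finite metric spaces with positive integer distances containing no triangle of odd perimeter. A class $\mathcal K$ has coherent EPPA if for every $\mathbf A\in\mathcal K$ there is $\mathbf B\in\mathcal K$ containing $\mathbf A$ as a substructure such that every partial automorphism $f$ (isomorphism between substructures) of $\mathbf A$ extends to an automorphism $\hat f$ of $\mathbf B$, and whenever $\mathrm{Dom}(f)=\mathrm{Dom}(h)$, $\mathrm{Range}(f)=\mathrm{Dom}(g)$, $\mathrm{Range}(g)=\mathrm{Range}(h)$ and $h=g\circ f$, also $\hat h=\hat g\circ\hat f$. *)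

(* Defs.v *)
From mathcomp Require Import all_boot all_fingroup.

Set Implicit Arguments.
Unset Strict Implicit.
Unset Printing Implicit Defensive.

Record intMetric := IntMetric {
  point :> finType;
  dist : point -> point -> nat;
  dist_eq0 : forall x y, dist x y = 0 <-> x = y;
  dist_sym : forall x y, dist x y = dist y x;
  dist_triangle : forall x y z, dist x z <= dist x y + dist y z
}.

(* K1 ranges over {0, 1, 2, ...} together with infinity; None is infinity. *)
Definition one_le (K1 : option nat) : Prop :=
  if K1 is Some k then 1 <= k else True.

Definition lt_2K1_plus1 (p : nat) (K1 : option nat) : Prop :=
  if K1 is Some k then p < 2 * k + 1 else True.

Definition is_triangle (A : intMetric) (x y z : A) : Prop :=
  [/\ x <> y, y <> z & x <> z].

Definition perimeter (A : intMetric) (x y z : A) : nat :=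
  dist x y + dist y z + dist x z.

(* The class A^infty_{K1, infty, infty, infty}. *)
Definition classA_K1 (K1 : option nat) (A : intMetric) : Prop :=
  ~ exists x y z : A, [/\ is_triangle x y z, odd (perimeter x y z)
                        & lt_2K1_plus1 (perimeter x y z) K1].

(* The class A^infty_{infty, 0, infty, infty}. *)
Definition classA_bip (A : intMetric) : Prop :=
  ~ exists x y z : A, is_triangle x y z /\ odd (perimeter x y z).

(* A partial map on A is f : {ffun A -> option A}, undefined where the value
   is None. *)
Definition Dom (A : intMetric) (f : {ffun A -> option A}) : {set A} :=
  [set x | f x != None].

Definition Range (A : intMetric) (f : {ffun A -> option A}) : {set A} :=
  [set y | [exists x, f x == Some y]].

Definition pcomp (A : intMetric) (g f : {ffun A -> option A}) :
  {ffun A -> option A} := [ffun x => obind g (f x)].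

Definition is_embedding (A B : intMetric) (e : A -> B) : Prop :=
  injective e /\ forall x y, dist (e x) (e y) = dist x y.

Definition is_automorphism (B : intMetric) (s : {perm B}) : Prop :=
  forall x y, dist (s x) (s y) = dist x y.

Definition is_partial_automorphism (A : intMetric)
  (f : {ffun A -> option A}) : Prop :=
  (forall x y z, f x = Some z -> f y = Some z -> x = y) /\
  (forall x y x' y', f x = Some x' -> f y = Some y' -> dist x' y' = dist x y).

Definition coherent_EPPA (K : intMetric -> Prop) : Prop :=
  forall A : intMetric, K A ->
  exists B : intMetric, K B /\
  exists e : A -> B, is_embedding e /\
  exists hat : {ffun A -> option A} -> {perm B},
    (forall f, is_partial_automorphism f ->
       is_automorphism (hat f) /\
       forall x x', f x = Some x' -> hat f (e x) = e x') /\
    (forall f g h,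
       is_partial_automorphism f -> is_partial_automorphism g ->
       is_partial_automorphism h ->
       Dom f = Dom h -> Range f = Dom g -> Range g = Range h ->
       h = pcomp g f ->
       forall b : B, hat h b = hat g (hat f b)).

(* Main.v *)
Require Import Defs.
From mathcomp Require Import all_boot all_fingroup.
From mathcomp Require Import ssralg zmodp zify.

(* Replace A by a finite edge-labelled graph on which all partial automorphisms
   extend coherently; its labels live in a cyclic group and are split between
   the two ends of an edge, so that an extension may be corrected by an
   antisymmetric cocycle.  Such a graph can be completed by its path metric as
   soon as it has no bad cycle, i.e. no cycle with an edge longer than the rest
   and no short odd cycle.  Bad cycles have bounded length, and a shortest one
   meets A in too few points to obstruct the following two-fold unwinding: each
   vertex gets one bit for every shortest bad cycle through it, and the bits of
   adjacent vertices agree except across the closing edge of the cycle.  For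
   the class without odd triangles one more cover, by parity, makes the graph
   bipartite. *)

Set Implicit Arguments.
Unset Strict Implicit.
Unset Printing Implicit Defensive.

(** * Walks in edge-labelled graphs and their weights *)

Section Walks.

Variables (V : Type) (lab : V -> V -> nat).

Definition edge (v w : V) : bool := lab v w != 0.

Fixpoint weight (v : V) (p : seq V) : nat :=
  if p is w :: p' then lab v w + weight w p' else 0.

Lemma weight_cat v p q : weight v (p ++ q) = weight v p + weight (last v p) q.
Proof. by elim: p v => //= w p IH v; rewrite IH addnA. Qed.

Lemma size_le_weight v p : path edge v p -> size p <= weight v p.
Proof.
elim: p v => //= w p IH v /andP[vw /IH].
by move: vw; rewrite /edge; lia.
Qed.

Lemma walk_rev v p : (forall x y, lab x y = lab y x) -> path edge v p ->
  exists q, [/\ path edge (last v p) q, last (last v p) q = v &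
                weight (last v p) q = weight v p].
Proof.
move=> sym; elim: p v => [|w p IH] v /=; first by exists [::].
case/andP=> vw /IH[q [pq lq wq]]; exists (q ++ [:: v]).
rewrite cat_path last_cat weight_cat /= pq lq wq /edge sym; split=> //.
  by rewrite andbT.
by rewrite addn0 addnC sym.
Qed.

End Walks.

Lemma walk_map (V V' : Type) (lab : V -> V -> nat) (lab' : V' -> V' -> nat)
    (g : V -> V') v p :
  (forall x y, edge lab x y -> lab' (g x) (g y) = lab x y) ->
  path (edge lab) v p ->
  path (edge lab') (g v) (map g p) /\
  weight lab' (g v) (map g p) = weight lab v p.
Proof.
move=> gE; elim: p v => //= w p IH v /andP[vw /IH[-> ->]].
by rewrite {1}/edge (gE _ _ vw) andbT.
Qed.

(** * Bad cycles *)

Definition short_odd (K n : nat) : bool := odd n && (n < 2 * K + 1).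

(* An edge of length c whose ends are joined by a walk of length s closes up to
   a cycle that either violates the triangle inequality or is short and odd. *)
Definition bad (K c s : nat) : bool := (s < c) || short_odd K (s + c).

Section Bad.

Variables (V : finType) (lab : V -> V -> nat) (K : nat).
Hypothesis lab_sym : forall v w, lab v w = lab w v.

Definition bad_walk (v : V) (p : seq V) : bool :=
  [&& path (edge lab) v p, edge lab v (last v p)
    & bad K (lab v (last v p)) (weight lab v p)].

Definition no_bad (k : nat) : Prop :=
  forall v p, size p < k -> ~~ bad_walk v p.

Lemma no_bad_edge k v w p : no_bad k -> size p < k -> path (edge lab) v p ->
  last v p = w -> edge lab v w -> ~~ bad K (lab v w) (weight lab v p).
Proof.
move=> nb sp pp lp vw; have := nb v p sp.
by rewrite /bad_walk pp lp vw.
Qed.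

(** The first edge of the closed walk closes up the remaining walk, which is one step shorter; hence
    [<=] instead of [<]. *)
Lemma no_bad_closed k v p : no_bad k -> size p <= k -> path (edge lab) v p ->
  last v p = v -> ~~ short_odd K (weight lab v p).
Proof.
move=> nb; case: p => // w p /= sp /andP[vw pp] lp.
have wv : edge lab w v by rewrite /edge lab_sym.
have := no_bad_edge nb sp pp lp wv; rewrite /bad lab_sym negb_or addnC.
by case/andP.
Qed.

(** Each step weighs at least 1, and a bad walk weighs less than its closing label or than
    [2 * K + 1]. So only finitely many sizes have to be cleared of bad walks. *)
Lemma bad_walk_size v p n : (forall x y, lab x y <= n) ->
  bad_walk v p -> size p < n + 2 * K + 1.
Proof.
move=> le_n /and3P[pp _]; have := size_le_weight pp; have := le_n v (last v p).
by rewrite /bad /short_odd; lia.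
Qed.

(* The closing edge of a shortest bad cycle is not traversed by its walk. *)
Lemma bad_walk_closing_edge v p1 w p2 :
  let p := p1 ++ w :: p2 in
  no_bad (size p) -> bad_walk v p ->
  ~~ ((last v p1 == v) && (w == last v p) ||
      (w == v) && (last v p1 == last v p)).
Proof.
move=> p nb; rewrite /bad_walk.
have -> : last v p = last w p2 by rewrite /p last_cat.
rewrite /p cat_path weight_cat /= => /and3P[/and3P[pp1 e1 pp2] ec bd].
have s1 : size p1 < size p by rewrite /p size_cat /=; lia.
have s2 : size p2 < size p by rewrite /p size_cat /=; lia.
apply/negP => /orP[/andP[/eqP lv /eqP lw]|/andP[/eqP wv /eqP lv]].
  (* Forward traversal: without the two copies of the edge, a closed walk remains at each end, and
     one of the two is short and odd. *)
  have := no_bad_closed nb (ltnW s1) pp1 lv.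
  have := no_bad_closed nb (ltnW s2) pp2 (esym lw).
  by move: bd; rewrite lv -lw /bad /short_odd; lia.
(* Backward traversal: [p1] and [p2] both join the ends of the closing edge; the two cycles they
   form with it have the original total weight, so one of them is short and odd. *)
subst w.
have := no_bad_edge nb s1 pp1 lv ec.
have := no_bad_edge nb s2 pp2 erefl ec.
move: bd; rewrite lv (lab_sym (last v p2)) /bad /short_odd; lia.
Qed.

End Bad.

(** * Labelled graphs with coherent extensions of partial automorphisms *)

Section Witness.

Variable A : intMetric.

Notation pmap := {ffun A -> option A}.

Definition coherent_triple (f g h : pmap) : Prop :=
  [/\ [/\ is_partial_automorphism f, is_partial_automorphism g &
          is_partial_automorphism h],
      Dom f = Dom h, Range f = Dom g, Range g = Range h & h = Defs.pcomp g f].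

Definition diam : nat := \max_(x : A) \max_(y : A) dist x y.

Lemma dist_le_diam (x y : A) : dist x y <= diam.
Proof.
apply: (leq_trans (leq_bigmax y)).
exact: (leq_bigmax (F := fun x : A => \max_(y : A) dist x y)).
Qed.

Lemma distxx (x : A) : dist x x = 0.
Proof. exact/dist_eq0. Qed.

(* The label 0 marks a non-edge. *)
Record witness := Witness {
  vert :> finType;
  lab : vert -> vert -> nat;
  emb : A -> vert;
  hat : pmap -> {perm vert};
  lab_sym : forall v w, lab v w = lab w v;
  labxx : forall v, lab v v = 0;
  lab_le : forall v w, lab v w <= diam;
  lab_emb : forall x y, lab (emb x) (emb y) = dist x y;
  lab_hat : forall f v w, is_partial_automorphism f ->
    lab (hat f v) (hat f w) = lab v w;
  hat_emb : forall f x y, is_partial_automorphism f -> f x = Some y ->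
    hat f (emb x) = emb y;
  hat_coherent : forall f g h v, coherent_triple f g h ->
    hat h v = hat g (hat f v)
}.

Lemma in_Dom (f : pmap) x y : f x = Some y -> x \in Dom f.
Proof. by rewrite inE => ->. Qed.

Lemma DomP (f : pmap) x : x \in Dom f -> exists y, f x = Some y.
Proof. by rewrite inE; case: (f x) => // y _; exists y. Qed.

Lemma RangeP (f : pmap) y : y \in Range f -> exists x, f x = Some y.
Proof. by rewrite inE => /existsP[x /eqP]; exists x. Qed.

Lemma in_Range (f : pmap) x y : f x = Some y -> y \in Range f.
Proof. by rewrite inE => fx; apply/existsP; exists x; apply/eqP. Qed.

(** * Covers of a witness by families of bits *)

Section Cover.

(** [T] indexes the bits, [mem v U] says that bit [U] matters at [v], [al U v w] prescribes its
    change from [v] to [w], and [tau x] lists the bits of the copy of [x] in the cover. *)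
Variables (W : witness) (T : finType) (mem : W -> T -> bool).
Variables (al : T -> W -> W -> bool) (act : pmap -> {perm T}).
Variable tau : A -> T -> bool.

Hypothesis al_sym : forall U v w, al U v w = al U w v.
Hypothesis act_coherent : forall f g h U, coherent_triple f g h ->
  act h U = act g (act f U).
Hypothesis mem_act : forall f v U, is_partial_automorphism f ->
  mem (hat W f v) (act f U) = mem v U.
Hypothesis al_act : forall f v w U, is_partial_automorphism f ->
  al (act f U) (hat W f v) (hat W f w) = al U v w.
Hypothesis tau_out : forall x U, ~~ mem (emb W x) U -> tau x U = false.
Hypothesis tau_al : forall x y U, x != y ->
  mem (emb W x) U -> mem (emb W y) U ->
  tau x U (+) tau y U = al U (emb W x) (emb W y).

(** Whether bit [U] must be reversed for the copy of [x] to reach that of its image. The value is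
    false if no point of the domain lies on [U]; coherence relies on this default. *)
Definition flip (f : pmap) (U : T) : bool :=
  [exists x, if f x is Some y
             then mem (emb W x) U && (tau y (act f U) != tau x U)
             else false].

(** All points of the domain on [U] demand the same flip: by [tau_al], their bits differ by [al],
    which [f] preserves. *)
Lemma flipE f x y U : is_partial_automorphism f -> f x = Some y ->
  mem (emb W x) U -> flip f U = tau y (act f U) (+) tau x U.
Proof.
move=> fA fx mx; apply/existsP/idP => [[x']|neq]; last first.
  by exists x; rewrite fx mx; move: neq; do 2 case: tau.
case fx': (f x') => [y'|//] /andP[mx' neq].
have [xx'|xx'] := eqVneq x x'.
  by move: fx' neq; rewrite -xx' fx => -[<-]; do 2 case: tau.
have yy' : y != y'.
  by apply: contra_neq xx' => yy'; apply: fA.1 fx _; rewrite yy'.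
have my : mem (emb W y) (act f U) by rewrite -(hat_emb W fA fx) mem_act.
have my' : mem (emb W y') (act f U) by rewrite -(hat_emb W fA fx') mem_act.
have := tau_al yy' my my'; rewrite -(hat_emb W fA fx) -(hat_emb W fA fx').
rewrite al_act // -(tau_al xx' mx mx').
by move: neq; do 4 case: tau.
Qed.

Lemma flip_coherent f g h U : coherent_triple f g h ->
  flip h U = flip f U (+) flip g (act f U).
Proof.
move=> coh; have [[fA gA hA] Dfh Rfg _ hE] := coh.
have [/existsP[x /andP[xD mx]]|] :=
  boolP [exists x, (x \in Dom f) && mem (emb W x) U].
  have [y fx] := DomP xD.
  have [z gy] : exists z, g y = Some z by apply: DomP; rewrite -Rfg (in_Range fx).
  have hx : h x = Some z by rewrite hE ffunE fx.
  have my : mem (emb W y) (act f U) by rewrite -(hat_emb W fA fx) mem_act.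
  rewrite (flipE hA hx mx) (flipE fA fx mx) (flipE gA gy my).
  by rewrite (act_coherent _ coh); do 3 case: tau.
rewrite negb_exists => /forallP no.
have -> : flip h U = false.
  apply/existsP => -[x]; case hx: (h x) => [z|//] /andP[mx _].
  by have := no x; rewrite mx Dfh (in_Dom hx).
have -> : flip f U = false.
  apply/existsP => -[x]; case fx: (f x) => [z|//] /andP[mx _].
  by have := no x; rewrite mx (in_Dom fx).
(* A point of [Dom g] on [act f U] would come from a point of [Dom f] on [U]. *)
apply/esym/existsP => -[y]; case gy: (g y) => [z|//] /andP[my _].
have [x fx] : exists x, f x = Some y by apply: RangeP; rewrite Rfg (in_Dom gy).
have := no x; rewrite (in_Dom fx) -(mem_act _ _ fA) (hat_emb W fA fx).
by rewrite my.
Qed.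

Definition cover_vert : finType := (W * {ffun T -> bool})%type.

Definition cover_compat (a b : cover_vert) : bool :=
  [forall U, mem a.1 U && mem b.1 U ==> (a.2 U (+) b.2 U == al U a.1 b.1)].

Definition cover_lab (a b : cover_vert) : nat :=
  if cover_compat a b then lab a.1 b.1 else 0.

Definition cover_emb (x : A) : cover_vert := (emb W x, [ffun U => tau x U]).

(** A flip affects all vertices supporting the bit at once, so it changes no difference that
    [cover_compat] tests. *)
Definition cover_hat_fun (f : pmap) (a : cover_vert) : cover_vert :=
  (hat W f a.1,
   [ffun U => let U' := (act f)^-1%g U in a.2 U' (+) (mem a.1 U' && flip f U')]).

Lemma cover_hat_funE f a U :
  (cover_hat_fun f a).2 (act f U) = a.2 U (+) (mem a.1 U && flip f U).
Proof. by rewrite ffunE /= permK. Qed.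

Lemma cover_hat_inj f : injective (cover_hat_fun f).
Proof.
move=> [v chi] [w psi] eq_vw; have [/perm_inj vw _] := eq_vw.
rewrite -vw in eq_vw *; congr pair; apply/ffunP => U.
have := cover_hat_funE f (v, chi) U; rewrite eq_vw cover_hat_funE /=.
by move/addIb.
Qed.

Definition cover_hat f : {perm cover_vert} := perm (@cover_hat_inj f).

Lemma cover_lab_sym a b : cover_lab a b = cover_lab b a.
Proof.
rewrite /cover_lab lab_sym; congr (if _ then _ else _).
by apply: eq_forallb => U; rewrite andbC addbC al_sym.
Qed.

Lemma cover_labxx a : cover_lab a a = 0.
Proof. by rewrite /cover_lab labxx if_same. Qed.

Lemma cover_lab_le a b : cover_lab a b <= diam.
Proof. by rewrite /cover_lab; case: ifP => // _; apply: lab_le. Qed.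

Lemma cover_lab_emb x y : cover_lab (cover_emb x) (cover_emb y) = dist x y.
Proof.
have [->|xy] := eqVneq x y; first by rewrite cover_labxx distxx.
rewrite /cover_lab lab_emb ifT //; apply/forallP => U; apply/implyP => /=.
by case/andP=> mx my; rewrite !ffunE tau_al.
Qed.

Lemma cover_lab_hat f a b : is_partial_automorphism f ->
  cover_lab (cover_hat f a) (cover_hat f b) = cover_lab a b.
Proof.
move=> fA; rewrite !permE /cover_lab lab_hat //; congr (if _ then _ else _).
apply/forallP/forallP => H U.
  have := H (act f U); rewrite !cover_hat_funE /= !mem_act // al_act //.
  case: (mem a.1 U); case: (mem b.1 U) => //=.
  by case: (a.2 U); case: (b.2 U); case: (flip f U).
rewrite -[U](permKV (act f)) !cover_hat_funE /= !mem_act // al_act //.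
have := H ((act f)^-1%g U); set U' := (act f)^-1%g U.
case: (mem a.1 U'); case: (mem b.1 U') => //=.
by case: (a.2 U'); case: (b.2 U'); case: (flip f U').
Qed.

Lemma cover_hat_emb f x y : is_partial_automorphism f -> f x = Some y ->
  cover_hat f (cover_emb x) = cover_emb y.
Proof.
move=> fA fx; rewrite permE /cover_emb; congr pair; first exact: hat_emb.
apply/ffunP => U; rewrite -[U](permKV (act f)) cover_hat_funE /= !ffunE.
set U' := (act f)^-1%g U.
have [mx|mx] := boolP (mem (emb W x) U').
  by rewrite (flipE fA fx mx); do 2 case: tau.
by rewrite !tau_out // -(hat_emb W fA fx) mem_act.
Qed.

Lemma cover_hat_coherent f g h a : coherent_triple f g h ->
  cover_hat h a = cover_hat g (cover_hat f a).
Proof.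
move=> coh; have [[fA gA hA] _ _ _ _] := coh; rewrite !permE.
case: a => v chi; congr pair => /=; first exact: hat_coherent.
apply/ffunP => U; rewrite -[U](permKV (act h)); set U' := (act h)^-1%g U.
have := cover_hat_funE h (v, chi) U'; rewrite /= => ->.
rewrite (act_coherent _ coh).
have := cover_hat_funE g (cover_hat_fun f (v, chi)) (act f U').
rewrite /= => ->; have := cover_hat_funE f (v, chi) U'; rewrite /= => ->.
rewrite mem_act // (flip_coherent _ coh).
by case: mem; case: (flip f U'); case: (flip g _); case: (chi U').
Qed.

Definition cover : witness :=
  Witness cover_lab_sym cover_labxx cover_lab_le cover_lab_emb cover_lab_hat
    cover_hat_emb cover_hat_coherent.

Lemma cover_edge (a b : cover) : edge (@lab cover) a b ->
  lab a b = lab a.1 b.1 /\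
  (forall U, mem a.1 U -> mem b.1 U -> a.2 U (+) b.2 U = al U a.1 b.1).
Proof.
rewrite /edge /= /cover_lab; case: ifP => // /forallP cab _; split=> // U ma mb.
by have := cab U; rewrite ma mb => /eqP.
Qed.

Lemma cover_hat_diff f (a b : cover) U : mem a.1 U -> mem b.1 U ->
  (hat cover f a).2 (act f U) (+) (hat cover f b).2 (act f U)
  = a.2 U (+) b.2 U.
Proof.
move=> ma mb; rewrite /= !permE !cover_hat_funE ma mb /=.
by case: (a.2 U); case: (b.2 U); case: (flip f U).
Qed.

End Cover.

(** * Unwinding the shortest bad cycles *)

Section Unwind.

Variables (W : witness) (K k : nat).

Hypothesis good_A : forall x y z : A,
  ~~ short_odd K (dist x y + dist y z + dist x z).
Hypothesis nb : no_bad (@lab W) K k.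

(** All walks with [k] steps, bad or not; those that are not bad get empty support through [mem]. *)
Let T : finType := (W * k.-tuple W)%type.

Let bw (U : T) : bool := bad_walk (@lab W) K U.1 U.2.

Let mem (v : W) (U : T) : bool := bw U && (v \in U.1 :: U.2).

Let al (U : T) (v w : W) : bool :=
  (v == U.1) && (w == last U.1 U.2) || (w == U.1) && (v == last U.1 U.2).

Let act_fun (f : pmap) (U : T) : T := (hat W f U.1, map_tuple (hat W f) U.2).

Let act_inj f : injective (act_fun f).
Proof.
move=> [v p] [w q] [/perm_inj -> /inj_map eq_pq]; congr pair.
by apply/val_inj/eq_pq/perm_inj.
Qed.

Let act f : {perm T} := perm (@act_inj f).

(** Marks the far end of the closing edge. If the near end is outside the copy of [A], no pair from
    [A] is the closing edge, so the bits on [A] must all agree and nothing is marked. *)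
Let tau (x : A) (U : T) : bool :=
  [&& bw U, emb W x == last U.1 U.2 & [exists z, emb W z == U.1]].

Let bw_act f U : is_partial_automorphism f -> bw (act f U) = bw U.
Proof.
move=> fA; have hatE v w : lab (hat W f v) (hat W f w) = lab v w.
  exact: lab_hat.
rewrite permE /bw /bad_walk /= last_map {2}/edge !hatE.
have -> : path (edge (@lab W)) (hat W f U.1) (map (hat W f) U.2)
          = path (edge (@lab W)) U.1 U.2.
  by rewrite path_map; apply: eq_path => v w; rewrite /= /edge hatE.
suff -> : weight (@lab W) (hat W f U.1) (map (hat W f) U.2)
          = weight (@lab W) U.1 U.2 by [].
by case: U => v [p _] /=; elim: p v => //= w p IH v; rewrite IH hatE.
Qed.

Let act_coherent f g h U : coherent_triple f g h -> act h U = act g (act f U).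
Proof.
move=> coh; rewrite !permE /act_fun /=; congr pair; first exact: hat_coherent.
apply: val_inj; rewrite /= -map_comp; apply: eq_map => v /=.
exact: hat_coherent.
Qed.

Let mem_act f v U : is_partial_automorphism f ->
  mem (hat W f v) (act f U) = mem v U.
Proof.
move=> fA; rewrite /mem bw_act // permE /= -map_cons.
by rewrite (mem_map (@perm_inj _ (hat W f))).
Qed.

Let al_act f v w U : is_partial_automorphism f ->
  al (act f U) (hat W f v) (hat W f w) = al U v w.
Proof.
by move=> fA; rewrite /al permE /= last_map !(inj_eq (@perm_inj _ (hat W f))).
Qed.

Let al_sym U v w : al U v w = al U w v.
Proof. by rewrite /al orbC. Qed.

Let tau_out x U : ~~ mem (emb W x) U -> tau x U = false.
Proof.
rewrite /mem /tau; case: bw => //= nx; apply/andP => -[/eqP xl _].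
by rewrite xl mem_last in nx.
Qed.

(* A point of A on a shortest bad cycle cuts it into two shorter cycles and a
   triangle of A, none of which is bad. *)
Let no_inner (x y z : A) U : bw U -> emb W z = U.1 ->
  emb W x = last U.1 U.2 -> emb W y \in U.1 :: U.2 -> (y == x) || (y == z).
Proof.
case: U => v p /= bU ez ex; rewrite inE => /orP[/eqP ey|yp].
  have : dist y z = 0 by rewrite -(lab_emb W) ey -ez labxx.
  by move/dist_eq0 ->; rewrite eqxx orbT.
apply/negPn; rewrite negb_or; apply/negP => /andP[yx yz].
have e_edge a b : a != b -> edge (@lab W) (emb W a) (emb W b).
  by rewrite /edge lab_emb; apply: contra_neq => /dist_eq0.
have sp := size_tuple p.
move: bU ex sp; rewrite /bw /=; case/splitPr: {p}(tval p) / yp => p1 p2.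
rewrite last_cat /= => bU ex sp.
have pp1 : path (edge (@lab W)) v (p1 ++ [:: emb W y]).
  by move: bU; rewrite /bad_walk !cat_path /= => /and3P[/and3P[-> ->]].
have pp2 : path (edge (@lab W)) (emb W y) p2.
  by move: bU; rewrite /bad_walk !cat_path /= => /and3P[/and3P[_ _ ->]].
have s2 : size p2 < k by rewrite -sp size_cat /=; lia.
(* The part [p2] is nonempty, as otherwise [y] would be the end [x]. *)
have s1 : size (p1 ++ [:: emb W y]) < k.
  rewrite -sp !size_cat /= ltn_add2l; case: (p2) ex => //= ex.
  have : dist x y = 0 by rewrite -(lab_emb W) ex labxx.
  by move/dist_eq0 => xy; rewrite xy eqxx in yx.
have vy : edge (@lab W) v (emb W y) by rewrite -ez e_edge // eq_sym.
have := no_bad_edge nb s1 pp1 (last_cat _ _ _) vy.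
have := no_bad_edge nb s2 pp2 (esym ex) (e_edge _ _ yx).
have /and3P[_ _] := bU.
rewrite last_cat /= -ex -ez !lab_emb !weight_cat /= addn0.
move: (weight _ _ p1) (weight _ _ p2) (lab _ _) => a b c.
(* The perimeters of the three pieces add up to that of the bad cycle modulo 2, and none exceeds it,
   so a short odd cycle would leave a short odd piece. *)
have := good_A z y x; have := dist_triangle z y x; have := dist_triangle z x y.
have := dist_triangle y z x; rewrite (dist_sym x y) (dist_sym y z).
rewrite /bad /short_odd.
move: (dist z y) (dist z x) (dist y x) => d1 d2 d3; lia.
Qed.

(** If the start lies in [A] and one point is the end, [no_inner] makes the other the start and both
    sides are true; in all other cases both are false. *)
Let tau_al x y U : x != y -> mem (emb W x) U -> mem (emb W y) U ->
  tau x U (+) tau y U = al U (emb W x) (emb W y).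
Proof.
move=> xy /andP[bU mx] /andP[_ my].
have emb_inj a b : emb W a = emb W b -> a = b.
  by move=> ab; apply/dist_eq0; rewrite -(lab_emb W) ab labxx.
have neq : U.1 != last U.1 U.2.
  have /and3P[_ + _] := bU; apply: contraTneq => eqU.
  by rewrite /edge -eqU labxx.
have [[z /eqP ez]|noz] := altP (@existsP A (fun z => emb W z == U.1)); last first.
  move: noz; rewrite negb_exists => /forallP noz.
  rewrite /tau /al bU (negbTE (noz x)) (negbTE (noz y)).
  by rewrite !(introF existsP) ?andbF // => -[z]; rewrite (negbTE (noz z)).
have exz : [exists z, emb W z == U.1] by apply/existsP; exists z; apply/eqP.
rewrite /tau /al bU exz !andbT /=.
have zE a : (emb W a == U.1) = (a == z).
  by rewrite -ez; apply/eqP/eqP => [/emb_inj|->].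
rewrite !zE.
have [ex|ex] := eqVneq (emb W x) (last U.1 U.2).
  have := no_inner bU ez ex my; rewrite eq_sym (negbTE xy) /= => /eqP yz.
  by rewrite yz eqxx andbT ez (negbTE neq) /= andbF.
have [ey|ey] := eqVneq (emb W y) (last U.1 U.2).
  by have := no_inner bU ez ey mx; rewrite (negbTE xy) /= => ->.
by rewrite !andbF.
Qed.

(** A bad walk of size at most [k] in the cover projects to one of size exactly [k], which is itself
    an index [U]. Its bit [U] is constant along the walk, which avoids the closing edge, yet must
    change across that edge. *)
Lemma unwind : exists W' : witness, no_bad (@lab W') K k.+1.
Proof.
pose C := cover al_sym act_coherent mem_act al_act tau_out tau_al.
exists C => a p; rewrite ltnS => sp; apply/negP => /and3P[pp ea bd].
have prE (b c : C) : edge (@lab C) b c -> lab b.1 c.1 = lab b c.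
  by case/cover_edge.
have [pp1 wE] := walk_map prE pp.
have ea1 : edge (@lab W) a.1 (last a p).1 by rewrite /edge prE.
have bw1 : bad_walk (@lab W) K a.1 (map fst p).
  by rewrite /bad_walk last_map pp1 ea1 wE prE.
have sp1 : size (map fst p) = k.
  apply/eqP; rewrite size_map eqn_leq sp leqNgt /=; apply/negP => ltk.
  by have := @nb a.1 (map fst p); rewrite size_map ltk bw1 => /(_ isT).
pose U : T := (a.1, tcast sp1 (in_tuple (map fst p))).
have UE : tval U.2 = map fst p by rewrite val_tcast.
have bU : bw U by rewrite /bw UE.
have mU b : b \in a :: p -> mem b.1 U.
  by move=> bp; rewrite /mem bU UE; apply: (map_f fst bp).
have const q1 q2 : p = q1 ++ q2 -> a.2 U = (last a q1).2 U.
  elim/last_ind: q1 q2 => //= q1 b IH q2; rewrite cat_rcons => pE.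
  rewrite (IH _ pE) last_rcons.
  have qb : edge (@lab C) (last a q1) b.
    by move: pp; rewrite pE cat_path /= => /and3P[].
  have ml : mem (last a q1).1 U.
    apply: mU; rewrite pE; have := mem_last a q1; rewrite !inE mem_cat.
    by case/orP=> ->; rewrite ?orbT.
  have mb : mem b.1 U by apply: mU; rewrite pE inE mem_cat inE eqxx !orbT.
  have [_ /(_ U ml mb)] := cover_edge qb.
  have -> : al U (last a q1).1 b.1 = false.
    have pE1 : map fst p = map fst q1 ++ b.1 :: map fst q2.
      by rewrite pE map_cat.
    have := bad_walk_closing_edge (@lab_sym W) (K := K) (v := a.1)
      (p1 := map fst q1) (w := b.1) (p2 := map fst q2).
    rewrite /= -pE1 sp1 => /(_ nb bw1) /negbTE.
    by rewrite /al UE !last_map.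
  by case: (b.2 U); case: ((last a q1).2 U).
have [_ /(_ U)] := cover_edge ea.
have := const p [::]; rewrite cats0 => /(_ erefl) ->; rewrite addbb.
move=> H; have := H (mU _ (mem_head _ _)) (mU _ (mem_last _ _)).
by rewrite /al UE /U /= last_map !eqxx.
Qed.

End Unwind.

(** * An initial witness from split labels *)

Section Initial.

(** The complements of domain and range are matched in enumeration order. The matching depends on
    these two sets only, so it composes coherently. *)
Definition pext_fun (f : pmap) (x : A) : A :=
  if f x is Some y then y
  else nth x (enum (~: Range f)) (index x (enum (~: Dom f))).

Lemma card_Dom (f : pmap) : is_partial_automorphism f -> #|Dom f| = #|Range f|.
Proof.
move=> fA; have Sinj : injective (@Some A) by move=> x y [].
rewrite -[RHS](card_imset _ Sinj).
have <- : f @: Dom f = Some @: Range f.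
  apply/setP => o; apply/imsetP/imsetP => -[].
    by move=> x /DomP[y fx] ->; exists y; rewrite ?(in_Range fx).
  by move=> y /RangeP[x fx] ->; exists x; rewrite ?(in_Dom fx).
rewrite card_in_imset // => x y /DomP[x' fx] /DomP[y' fy] fxy.
exact: fA.1 fx (etrans (esym fxy) fx).
Qed.

Lemma index_enum_Range (f : pmap) x : is_partial_automorphism f -> x \notin Dom f ->
  index x (enum (~: Dom f)) < size (enum (~: Range f)).
Proof.
move=> fA xD.
have -> : size (enum (~: Range f)) = size (enum (~: Dom f)).
  by rewrite -!cardE [LHS]cardsCs [RHS]cardsCs !setCK card_Dom.
by rewrite index_mem mem_enum inE.
Qed.

Lemma notin_Dom (f : pmap) x : x \notin Dom f -> f x = None.
Proof. by rewrite inE negbK => /eqP. Qed.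

Lemma pext_fun_Dom (f : pmap) x :
  is_partial_automorphism f -> (pext_fun f x \in Range f) = (x \in Dom f).
Proof.
move=> fA; have [/DomP[y fx]|xD] := boolP (x \in Dom f).
  by rewrite /pext_fun fx (in_Range fx).
rewrite /pext_fun (notin_Dom xD).
have := mem_nth x (index_enum_Range fA xD).
by rewrite mem_enum inE => /negbTE.
Qed.

Lemma pext_fun_inj f : is_partial_automorphism f -> injective (pext_fun f).
Proof.
move=> fA x y xy.
have : (x \in Dom f) = (y \in Dom f) by rewrite -!pext_fun_Dom // xy.
have [/DomP[x' fx] /esym/DomP[y' fy]|xD /esym/negbT yD] := boolP (x \in Dom f).
  by move: xy; rewrite /pext_fun fx fy => xy; apply: fA.1 fx _; rewrite xy.
move: xy; rewrite /pext_fun (notin_Dom xD) (notin_Dom yD).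
have ly := index_enum_Range fA yD.
rewrite (set_nth_default x y ly) => /eqP.
rewrite nth_uniq ?enum_uniq ?index_enum_Range // => /eqP.
have in_enum z : z \notin Dom f -> z \in enum (~: Dom f) by rewrite mem_enum in_setC.
by move=> ixy; rewrite -(nth_index x (in_enum _ xD)) ixy nth_index ?in_enum.
Qed.

(** The identity is a placeholder, never reached by partial automorphisms. *)
Definition pext (f : pmap) : {perm A} :=
  if injectiveP (pext_fun f) is ReflectT inj then perm inj else 1%g.

Lemma pextE f x : is_partial_automorphism f -> pext f x = pext_fun f x.
Proof.
move=> fA; rewrite /pext; case: injectiveP => [inj|[]]; first by rewrite permE.
exact: pext_fun_inj.
Qed.

Lemma pext_Some f x y : is_partial_automorphism f -> f x = Some y ->
  pext f x = y.
Proof. by move=> fA fx; rewrite pextE // /pext_fun fx. Qed.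

Lemma pext_Dom f x : is_partial_automorphism f ->
  (pext f x \in Range f) = (x \in Dom f).
Proof. by move=> fA; rewrite pextE // pext_fun_Dom. Qed.

Lemma pext_coherent f g h x : coherent_triple f g h ->
  pext h x = pext g (pext f x).
Proof.
move=> [[fA gA hA] Dfh Rfg Rgh hE].
have [/DomP[y fx]|xD] := boolP (x \in Dom f).
  have [z gy] : exists z, g y = Some z by apply: DomP; rewrite -Rfg (in_Range fx).
  have hx : h x = Some z by rewrite hE ffunE fx.
  by rewrite (pext_Some fA fx) (pext_Some gA gy) (pext_Some hA hx).
have yD : pext f x \notin Dom g by rewrite -Rfg pext_Dom.
have xDh : x \notin Dom h by rewrite -Dfh.
have ih := index_enum_Range hA xDh; have ig := index_enum_Range gA yD.
rewrite [LHS]pextE // [RHS]pextE // /pext_fun.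
rewrite (notin_Dom xDh) (notin_Dom yD) (set_nth_default x _ ig) Rgh -Dfh.
congr nth; rewrite pextE // /pext_fun (notin_Dom xD) -Rfg.
by rewrite index_uniq ?enum_uniq // index_enum_Range.
Qed.

Local Open Scope ring_scope.
Import GRing.Theory.

Local Notation Z := 'I_diam.+1.

(* Splits the distance of a pair into two summands, one for each end. *)
Definition half (x y : A) : Z :=
  if (enum_rank x < enum_rank y)%N then inord (dist x y) else 0.

Lemma half_sum x y : x != y -> half x y + half y x = inord (dist x y).
Proof.
move=> xy; rewrite /half (dist_sym y x).
case: (ltngtP (enum_rank x) (enum_rank y)) => [||/val_inj/enum_rank_inj/eqP].
- by rewrite addr0.
- by rewrite add0r.
- by rewrite (negbTE xy).
Qed.

(** The first case carries the copy of [x] to that of its image; the second is forced by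
    antisymmetry, which preserves labels. *)
Definition shift (f : pmap) (x y : A) : Z :=
  if x \in Dom f then half (pext f x) (pext f y) - half x y
  else if y \in Dom f then half y x - half (pext f y) (pext f x) else 0.

(** With both points in the domain, the halves add up to the distances before and after [f], which
    are equal. *)
Lemma shift_anti f x y : is_partial_automorphism f -> x != y ->
  shift f x y + shift f y x = 0.
Proof.
move=> fA xy; rewrite /shift.
have [xD|_] := boolP (x \in Dom f); have [yD|_] := boolP (y \in Dom f).
- rewrite addrACA half_sum ?(inj_eq perm_inj) // -opprD half_sum //.
  have [[x' fx] [y' fy]] := (DomP xD, DomP yD).
  rewrite (pext_Some fA fx) (pext_Some fA fy) (fA.2 _ _ _ _ fx fy).
  by rewrite subrr.
- by rewrite addrC addrA subrK subrr.
- by rewrite addrC addrA subrK subrr.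
- by rewrite addr0.
Qed.

(** The halves telescope, and all three shifts fall into the same case since [Dom h = Dom f] and
    [Dom g = Range f]. *)
Lemma shift_coherent f g h x y : coherent_triple f g h ->
  shift h x y = shift f x y + shift g (pext f x) (pext f y).
Proof.
move=> coh; have [[fA gA hA] Dfh Rfg Rgh hE] := coh.
rewrite /shift -Dfh -Rfg !pext_Dom // !(pext_coherent _ coh).
case: ifP => _; first by rewrite [RHS]addrC addrA subrK.
by case: ifP => _; rewrite ?addr0 // addrA subrK.
Qed.

Definition init_vert : finType := (A * {ffun A -> Z})%type.

(** The sum is taken modulo [diam + 1], so every value is a label at most [diam] or the non-edge
    0. *)
Definition init_lab (a b : init_vert) : nat :=
  if a.1 == b.1 then 0%N else (a.2 b.1 + b.2 a.1 : Z).

Definition init_emb (x : A) : init_vert := (x, [ffun y => half x y]).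

Definition init_hat_fun (f : pmap) (a : init_vert) : init_vert :=
  (pext f a.1,
   [ffun z => let y := (pext f)^-1%g z in a.2 y + shift f a.1 y]).

Lemma init_hat_funE f a y :
  (init_hat_fun f a).2 (pext f y) = a.2 y + shift f a.1 y.
Proof. by rewrite ffunE /= permK. Qed.

Lemma init_hat_inj f : injective (init_hat_fun f).
Proof.
move=> [x chi] [y psi] eq_xy; have [/perm_inj xy _] := eq_xy.
rewrite -xy in eq_xy *; congr pair; apply/ffunP => z.
have := init_hat_funE f (x, chi) z; rewrite eq_xy init_hat_funE /=.
by move/addIr.
Qed.

Definition init_hat f : {perm init_vert} := perm (@init_hat_inj f).

Lemma init_lab_sym a b : init_lab a b = init_lab b a.
Proof. by rewrite /init_lab eq_sym addrC. Qed.

Lemma init_labxx a : init_lab a a = 0%N.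
Proof. by rewrite /init_lab eqxx. Qed.

Lemma init_lab_le a b : (init_lab a b <= diam)%N.
Proof. by rewrite /init_lab; case: ifP => // _; rewrite -ltnS ltn_ord. Qed.

Lemma init_lab_emb x y : init_lab (init_emb x) (init_emb y) = dist x y.
Proof.
rewrite /init_lab -[(init_emb x).1]/x -[(init_emb y).1]/y.
have [->|xy] := eqVneq x y; first by rewrite distxx.
by rewrite !ffunE half_sum // inordK // ltnS dist_le_diam.
Qed.

Lemma init_lab_hat f a b : is_partial_automorphism f ->
  init_lab (init_hat f a) (init_hat f b) = init_lab a b.
Proof.
move=> fA; rewrite !permE /init_lab -[(init_hat_fun f a).1]/(pext f a.1).
rewrite -[(init_hat_fun f b).1]/(pext f b.1) (inj_eq perm_inj) !init_hat_funE.
have [//|ab] := eqVneq a.1 b.1.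
by rewrite addrACA shift_anti // addr0.
Qed.

Lemma init_hat_emb f x y : is_partial_automorphism f -> f x = Some y ->
  init_hat f (init_emb x) = init_emb y.
Proof.
move=> fA fx; rewrite permE /init_emb; congr pair; first exact: pext_Some.
apply/ffunP => z; rewrite -[z](permKV (pext f)) init_hat_funE /= !ffunE.
by rewrite /shift (in_Dom fx) (pext_Some fA fx) addrC subrK.
Qed.

Lemma init_hat_coherent f g h a : coherent_triple f g h ->
  init_hat h a = init_hat g (init_hat f a).
Proof.
move=> coh; rewrite !permE; congr pair => /=; first exact: pext_coherent.
apply/ffunP => z; rewrite -[z](permKV (pext h)).
set y := (pext h)^-1%g z; have := init_hat_funE h a y; rewrite /= => ->.
rewrite (pext_coherent _ coh).
have := init_hat_funE g (init_hat_fun f a) (pext f y); rewrite /= => ->.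
have := init_hat_funE f a y; rewrite /= => ->.
by rewrite (shift_coherent _ _ coh) addrA.
Qed.

Definition init : witness :=
  Witness init_lab_sym init_labxx init_lab_le init_lab_emb init_lab_hat
    init_hat_emb init_hat_coherent.

End Initial.

(** * Witnesses without bad cycles, and their parity cover *)

Lemma exists_no_bad K :
  (forall x y z : A, ~~ short_odd K (dist x y + dist y z + dist x z)) ->
  exists W : witness, forall k, no_bad (@lab W) K k.
Proof.
move=> good_A.
(* This is the bound of [bad_walk_size], beyond which no walk is bad. The induction starts at [init]
   because [no_bad] is vacuous at 0. *)
have [W nbW] : exists W : witness, no_bad (@lab W) K (diam + 2 * K + 1).
  elim: (diam + _ + _) => [|k [W nb]]; first by exists init.
  exact: unwind nb.
exists W => k v p _; apply/negP => bw; have := bad_walk_size (@lab_le W) bw.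
by move/(nbW v)/negP.
Qed.

(** The cover has a single bit, supported everywhere, which changes exactly across odd edges and
    serves as the colour. Bad walks would project to bad walks below. *)
Lemma exists_bipartite_no_bad K :
  (forall x y z : A, ~~ odd (dist x y + dist y z + dist x z)) ->
  exists (W : witness) (col : W -> bool),
    [/\ forall k, no_bad (@lab W) K k,
        forall v w, edge (@lab W) v w -> odd (lab v w) = col v (+) col w &
        forall f v w, col (hat W f v) (+) col (hat W f w) = col v (+) col w].
Proof.
move=> even_A.
have [W nb] : exists W : witness, forall k, no_bad (@lab W) K k.
  by apply: exists_no_bad => x y z; rewrite /short_odd (negbTE (even_A _ _ _)).
pose mem (v : W) (U : unit) := true.
pose al (U : unit) (v w : W) := odd (lab v w).
(* Parity of the distance to a base point, consistent since all triangles of [A] are even. *)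
pose tau (x : A) (U : unit) :=
  if [pick z : A] is Some z then odd (dist z x) else false.
have al_sym U v w : al U v w = al U w v by rewrite /al lab_sym.
have act_coh f g h (U : unit) : coherent_triple f g h ->
  (1%g : {perm unit}) U = (1%g : {perm unit}) ((1%g : {perm unit}) U).
  by rewrite !perm1.
have mem_act f v U : is_partial_automorphism f ->
  mem (hat W f v) ((1%g : {perm unit}) U) = mem v U by [].
have al_act f v w U : is_partial_automorphism f ->
  al ((1%g : {perm unit}) U) (hat W f v) (hat W f w) = al U v w.
  by move=> fA; rewrite /al lab_hat.
have tau_out x U : ~~ mem (emb W x) U -> tau x U = false by [].
have tau_al x y U : x != y -> mem (emb W x) U -> mem (emb W y) U ->
  tau x U (+) tau y U = al U (emb W x) (emb W y).
  rewrite /al lab_emb /tau => _ _ _; case: pickP => [z _|/(_ x)//].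
  by have := even_A z x y; rewrite !oddD; do 3 case: odd.
pose C := @cover W _ mem al (fun=> 1%g) tau
  al_sym act_coh mem_act al_act tau_out tau_al.
exists C, (fun a : cover_vert W unit => a.2 tt); split.
- move=> k a p sp; apply/negP => /and3P[pp ea bd].
  have prE (b c : C) : edge (@lab C) b c -> lab b.1 c.1 = lab b c.
    by case/cover_edge.
  have [pp1 wE] := walk_map prE pp.
  have ea1 : edge (@lab W) a.1 (last a p).1 by rewrite /edge prE.
  have /negP[] : ~~ bad_walk (@lab W) K a.1 (map fst p).
    by apply: (nb k); rewrite size_map.
  by rewrite /bad_walk last_map pp1 ea1 wE prE.
- by move=> a b /cover_edge[-> /(_ tt isT isT)].
- by move=> f a b; rewrite -(@cover_hat_diff W _ mem al (fun=> 1%g) tau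
    al_sym act_coh mem_act al_act tau_out tau_al f a b tt) // !perm1.
Qed.

(** * Completion by the truncated path metric *)

Section Completion.

Variables (W : witness) (K M : nat) (col : W -> bool).

Hypothesis nb : forall k, no_bad (@lab W) K k.
Hypothesis col_hat : forall f v w, is_partial_automorphism f ->
  col (hat W f v) (+) col (hat W f w) = col v (+) col w.
Hypothesis M_gt : diam < M.

(** A walk of weight [s] has at most [s] steps, so a finite search suffices. *)
Definition joined (v w : W) (s : nat) : bool :=
  [exists n : 'I_s.+1, exists p : n.-tuple W,
    [&& path (edge (@lab W)) v p, last v p == w & weight (@lab W) v p == s]].

Lemma joinedP v w s : reflect
  (exists p, [/\ path (edge (@lab W)) v p, last v p = w &
                 weight (@lab W) v p = s])
  (joined v w s).
Proof.
apply: (iffP existsP) => [[n /existsP[p /and3P[pp /eqP lp /eqP wp]]]|].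
  by exists p.
move=> [p [pp lp wp]].
have sp : size p < s.+1 by rewrite ltnS -wp size_le_weight.
exists (Ordinal sp); apply/existsP; exists (in_tuple p) => /=.
by rewrite pp lp wp !eqxx.
Qed.

Lemma joined_sym v w s : joined v w s = joined w v s.
Proof.
suff {v w s} sub v w s : joined v w s -> joined w v s.
  by apply/idP/idP; apply: sub.
case/joinedP=> p [pp <- <-]; apply/joinedP.
have [q [pq lq wq]] := walk_rev (@lab_sym W) pp.
by exists q.
Qed.

Lemma joined_cat u v w s t : joined u v s -> joined v w t -> joined u w (s + t).
Proof.
case/joinedP=> p [pp <- <-] /joinedP[q [pq <- <-]]; apply/joinedP.
by exists (p ++ q); rewrite cat_path last_cat weight_cat pp pq.
Qed.

Lemma joined0 v w : joined v w 0 = (v == w).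
Proof.
apply/joinedP/eqP => [[[|u p] [] //=]|->]; last by exists [::].
by case/andP; rewrite /edge; lia.
Qed.

Definition cap (v w : W) : nat := M + (col v (+) col w).

(* The path metric, truncated so that it stays finite on distinct components;
   the colour term keeps its parity right in the bipartite case. *)
Definition cdist (v w : W) : nat := find (joined v w) (iota 0 (cap v w)).

Lemma cdist_cap v w : cdist v w <= cap v w.
Proof.
by rewrite /cdist; apply: leq_trans (find_size _ _) _; rewrite size_iota.
Qed.

Lemma cdist_joined v w : cdist v w < cap v w -> joined v w (cdist v w).
Proof.
move=> lt_cap; have := lt_cap; rewrite /cdist -{2}(size_iota 0 (cap v w)).
by rewrite -has_find => /(nth_find 0); rewrite nth_iota.
Qed.

Lemma cdist_min v w s : joined v w s -> cdist v w <= s.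
Proof.
move=> jvw; rewrite leqNgt; apply/negP => lt_s.
have lt_cap := leq_trans lt_s (cdist_cap v w).
by have := before_find 0 lt_s; rewrite nth_iota // add0n jvw.
Qed.

Lemma capC v w : cap v w = cap w v.
Proof. by rewrite /cap addbC. Qed.

Lemma cdist_eq0 v w : cdist v w = 0 <-> v = w.
Proof.
split=> [d0|->]; last first.
  by apply/eqP; rewrite -leqn0 cdist_min // joined0.
apply/eqP; rewrite -joined0 -d0 cdist_joined // d0 /cap; lia.
Qed.

Lemma cdist_sym v w : cdist v w = cdist w v.
Proof.
by rewrite /cdist capC; apply: eq_find => s; rewrite joined_sym.
Qed.

(** If a side on the right is capped, the caps differ by at most 1, which a nonzero other side makes
    up for; otherwise the two walks are concatenated. *)
Lemma cdist_triangle u v w : cdist u w <= cdist u v + cdist v w.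
Proof.
have far x y z : cap x y <= cdist x y -> cdist x z <= cdist x y + cdist y z.
  move=> le_xy; have [/cdist_eq0 -> | nyz] := eqVneq (cdist y z) 0.
    by rewrite leq_addr.
  by have := cdist_cap x z; move: le_xy; rewrite /cap; lia.
have [le_uv|lt_uv] := leqP (cap u v) (cdist u v); first exact: far.
have [le_vw|lt_vw] := leqP (cap v w) (cdist v w).
  by rewrite addnC cdist_sym (cdist_sym v) (cdist_sym u) far // capC cdist_sym.
exact: cdist_min (joined_cat (cdist_joined lt_uv) (cdist_joined lt_vw)).
Qed.

Definition completion : intMetric :=
  IntMetric cdist_eq0 cdist_sym cdist_triangle.

(** A lighter walk between the ends would be bad; [diam < M] ensures that a distance below the label
    comes from a walk. *)
Lemma cdist_edge v w : edge (@lab W) v w -> cdist v w = lab v w.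
Proof.
move=> vw; apply/eqP; rewrite eqn_leq cdist_min; last first.
  by apply/joinedP; exists [:: w]; rewrite /= vw addn0.
rewrite leqNgt; apply/negP => lt_d.
have lt_cap : cdist v w < cap v w.
  by have := lab_le v w; rewrite /cap; lia.
have /joinedP[p [pp lp wp]] := cdist_joined lt_cap.
have := no_bad_edge (@nb (size p).+1) (ltnSn _) pp lp vw.
by rewrite wp /bad lt_d.
Qed.

Lemma joined_perm (s : {perm W}) v w n :
  (forall x y, lab (s x) (s y) = lab x y) ->
  joined (s v) (s w) n = joined v w n.
Proof.
suff sub (t : {perm W}) x y : (forall x y, lab (t x) (t y) = lab x y) ->
    joined x y n -> joined (t x) (t y) n.
  move=> sE; apply/idP/idP => [|]; last exact: sub.
  rewrite -{2}[v](permK s) -{2}[w](permK s); apply: sub => x y.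
  by rewrite -sE !permKV.
move=> tE /joinedP[p [pp <- <-]]; apply/joinedP; exists (map t p).
have [pt wt] := walk_map (lab' := @lab W) (g := t) (fun x y _ => tE x y) pp.
by rewrite last_map.
Qed.

Lemma completion_extends :
  exists e : A -> completion, is_embedding e /\
  exists hat : pmap -> {perm completion},
    (forall f, is_partial_automorphism f ->
       is_automorphism (hat f) /\
       forall x x', f x = Some x' -> hat f (e x) = e x') /\
    (forall f g h,
       is_partial_automorphism f -> is_partial_automorphism g ->
       is_partial_automorphism h ->
       Dom f = Dom h -> Range f = Dom g -> Range g = Range h ->
       h = Defs.pcomp g f ->
       forall b, hat h b = hat g (hat f b)).
Proof.
have embE x y : cdist (emb W x) (emb W y) = dist x y.
  have [->|xy] := eqVneq x y; first by rewrite distxx; apply/cdist_eq0.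
  rewrite cdist_edge ?lab_emb // /edge lab_emb.
  by apply: contra_neq xy => /dist_eq0.
exists (emb W : A -> completion); split.
  by split=> // x y xy; apply/dist_eq0; rewrite -embE xy; apply/cdist_eq0.
exists (hat W : pmap -> {perm completion}); split=> [f fA|].
  split=> [v w|x x']; last exact: hat_emb.
  rewrite /= /cdist /cap col_hat //; apply: eq_find => n.
  by apply: joined_perm => x y; apply: lab_hat.
by move=> f g h fA gA hA Dfh Rfg Rgh hE b; apply: hat_coherent.
Qed.

(** A capped side forces a perimeter of at least [2 * M] by the triangle inequality; otherwise the
    three walks form a closed walk of that weight. *)
Lemma completion_no_short_odd (u v w : completion) : K < M ->
  (forall x, col x = false) -> ~~ short_odd K (perimeter u v w).
Proof.
move=> ltKM col0; rewrite /perimeter /=.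
have capE x y : cap x y = M by rewrite /cap !col0 addn0.
have := cdist_triangle u v w; have := cdist_triangle v u w.
have := cdist_triangle u w v; rewrite (cdist_sym v u) (cdist_sym w v).
have [le_uv|lt_uv] := leqP (cap u v) (cdist u v).
  by move: le_uv; rewrite capE /short_odd; lia.
have [le_vw|lt_vw] := leqP (cap v w) (cdist v w).
  by move: le_vw; rewrite capE /short_odd; lia.
have [le_uw|lt_uw] := leqP (cap u w) (cdist u w).
  by move: le_uw; rewrite capE /short_odd; lia.
move=> _ _ _; have := cdist_joined lt_uw; rewrite joined_sym => juw.
have := joined_cat (joined_cat (cdist_joined lt_uv) (cdist_joined lt_vw)) juw.
case/joinedP=> p [pp lp <-].
exact: (no_bad_closed (@lab_sym W) (@nb (size p)) (leqnn _) pp lp).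
Qed.

(** Colours telescope along a walk, and an even [M] gives capped distances the same parity; around a
    triangle the colours cancel. *)
Lemma completion_bipartite (u v w : completion) : ~~ odd M ->
  (forall x y, edge (@lab W) x y -> odd (lab x y) = col x (+) col y) ->
  ~~ odd (perimeter u v w).
Proof.
move=> evM colE.
have oddE (x y : W) : odd (cdist x y) = col x (+) col y.
  have [le_xy|lt_xy] := leqP (cap x y) (cdist x y).
    have -> : cdist x y = cap x y by apply/eqP; rewrite eqn_leq cdist_cap.
    by rewrite /cap oddD (negbTE evM) oddb.
  have /joinedP[p [pp <- <-]] := cdist_joined lt_xy.
  elim: p x {lt_xy} pp => [|z p IH] x /=; first by rewrite addbb.
  by case/andP=> xz /IH pz; rewrite oddD colE // pz addbA addbK.
by rewrite /perimeter /= !oddD !oddE; do 3 case: col.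
Qed.

End Completion.

End Witness.

(** * Coherent EPPA for the two kinds of classes *)

Lemma odd_perimeter_triangle (A : intMetric) (x y z : A) :
  odd (perimeter x y z) -> is_triangle x y z.
Proof.
rewrite /perimeter => odd_p; split=> eq_xy; move: odd_p; rewrite eq_xy.
all: by rewrite distxx ?(dist_sym y z); lia.
Qed.

Lemma coherent_EPPA_short_odd (K : nat) : coherent_EPPA (classA_K1 (Some K)).
Proof.
move=> A KA.
have good_A (x y z : A) : ~~ short_odd K (dist x y + dist y z + dist x z).
  apply/negP => /andP[odd_p lt_p]; apply: KA; exists x, y, z; split=> //.
  exact: odd_perimeter_triangle.
have [W nb] := exists_no_bad good_A.
have M_gt : diam A < diam A + K + 1 by lia.
exists (completion (W := W) (fun=> false) M_gt); split; last first.
  exact: completion_extends nb _ _.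
move=> [x [y [z [_ odd_p lt_p]]]].
have ltKM : K < diam A + K + 1 by lia.
have /negP[] :=
  @completion_no_short_odd _ _ _ _ _ nb M_gt x y z ltKM (fun=> erefl).
exact/andP.
Qed.

Lemma coherent_EPPA_bipartite : coherent_EPPA classA_bip.
Proof.
move=> A bipA.
have even_A (x y z : A) : ~~ odd (dist x y + dist y z + dist x z).
  apply/negP => odd_p; apply: bipA; exists x, y, z; split=> //.
  exact: odd_perimeter_triangle.
(* For [K = 0] no cycle is short and odd: [bad] only tests the triangle inequality, and parity is
   left to the colouring. *)
have [W [col [nb colE col_hat]]] := exists_bipartite_no_bad 0 even_A.
have M_gt : diam A < (diam A).+1.*2 by lia.
exists (completion col M_gt); split; last first.
  by apply: completion_extends nb _ _ => f v w _; apply: col_hat.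
move=> [x [y [z [_]]]]; apply/negP.
by apply: completion_bipartite colE; rewrite odd_double.
Qed.

Theorem theorem8p3 :
  (forall K1 : option nat, one_le K1 -> coherent_EPPA (classA_K1 K1)) /\
  coherent_EPPA classA_bip.
Proof.
split=> [[K|] _|]; last exact: coherent_EPPA_bipartite.
  exact: coherent_EPPA_short_odd.
(* For infinite [K1] the perimeter bound is [True], so both classes have the same members. *)
have bipE (A : intMetric) : classA_K1 None A <-> classA_bip A.
  by split=> no [x [y [z H]]]; apply: no; exists x, y, z; case: H.
move=> A /bipE/coherent_EPPA_bipartite[B [/bipE KB extB]].
by exists B.
Qed.
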